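(* Let $k\in\mathbb N$, $f\in\mathcal R^k_{[1]}(\mathbb R^2)$ and $h\in\mathcal R^{k+1}_{[1]}(\mathbb R^2)$ such that $\mathrm{pol}(f)\subseteq\mathcal Z(h)$. Then $hf\in\mathcal R^{k+1}_{[1]}(\mathbb R^2)$.
   Context: For $k\in\mathbb N\cup\{\infty\}$, $\mathcal R^k(\mathbb R^2)$ denotes the ring of functions $f:\mathbb R^2\to\mathbb R$ of class $C^k$ that coincide with $p/q$ ($p,q$ polynomials, $q$ nonvanishing there) on some nonempty Zariski open set; $\mathrm{dom}(f)$ is the largest Zariski open set on which the associated rational function is regular and $\mathrm{pol}(f)=\mathbb R^2\setminus\mathrm{dom}(f)$. $\mathcal Z(h)$ is the zero set of $h$. For $l\in\mathbb N$: consider compositions $\pi:M\to\mathbb R^2$ of successive blowings-up $M_i\to M_{i-1}$ ($M_0=\mathbb R^2$), each centred at points. An infinitely near point of order $j$ is a sequence $a_0\in M_0,\dots,a_j\in M_j$ where $M_i$ is the blowing-up of $M_{i-1}$ at $a_{i-1}$ and $a_i$ maps to $a_{i-1}$; the number of stages of $\pi$ is the maximal order of infinitely near points in $M$. $\mathcal R^k_{[l]}(\mathbb R^2)$ is the set of $f\in\mathcal R^k(\mathbb R^2)$ for which there is such a $\pi$ with at most $l$ stages such that $f\circ\pi$ is regular on $M$. *)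

(* Defs.v *)
From Stdlib Require Import Reals List.
Open Scope R_scope.

Definition is_poly2 (p : R -> R -> R) : Prop :=
  exists (n : nat) (c : nat -> nat -> R),
    forall x y, p x y = sum_f_R0 (fun i => sum_f_R0 (fun j => c i j * x ^ i * y ^ j) n) n.

Definition cont2 (f : R -> R -> R) : Prop :=
  forall x y eps, 0 < eps -> exists delta, 0 < delta /\
    forall x' y', Rabs (x' - x) < delta -> Rabs (y' - y) < delta ->
      Rabs (f x' y' - f x y) < eps.

Fixpoint Ck2 (k : nat) (f : R -> R -> R) : Prop :=
  match k with
  | O => cont2 f
  | S k' => cont2 f /\
      exists fx fy : R -> R -> R,
        (forall x y, derivable_pt_lim (fun t => f t y) x (fx x y)) /\
        (forall x y, derivable_pt_lim (fun t => f x t) y (fy x y)) /\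
        Ck2 k' fx /\ Ck2 k' fy
  end.

(* R^k(R^2): C^k functions agreeing with p/q on a nonempty Zariski open set
   (every Zariski open set of R^2 contains a nonempty one of the form D(r)). *)
Definition regulous (k : nat) (f : R -> R -> R) : Prop :=
  Ck2 k f /\
  exists p q r, is_poly2 p /\ is_poly2 q /\ is_poly2 r /\
    (exists x0 y0, r x0 y0 <> 0) /\
    forall x y, r x y <> 0 -> q x y <> 0 /\ f x y = p x y / q x y.

Definition regular_at (g : R -> R -> R) (x y : R) : Prop :=
  exists p q, is_poly2 p /\ is_poly2 q /\ q x y <> 0 /\
    forall u v, q u v <> 0 -> g u v = p u v / q u v.

(* pol(f) = R^2 \ dom(f) ; for regulous f, dom(f) is the set of points
   where f is regular. *)
Definition pol (f : R -> R -> R) (x y : R) : Prop := ~ regular_at f x y.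

Definition Zset (h : R -> R -> R) (x y : R) : Prop := h x y = 0.

(* Standard affine charts of the blowing-up of R^2 at a = (a1,a2);
   the exceptional divisor is {u = 0} in chart 1 and {v = 0} in chart 2. *)
Definition chart1 (a : R * R) (f : R -> R -> R) : R -> R -> R :=
  fun u v => f (fst a + u) (snd a + u * v).
Definition chart2 (a : R * R) (f : R -> R -> R) : R -> R -> R :=
  fun u v => f (fst a + u * v) (snd a + v).

(* f o pi is regular on M, where pi : M -> R^2 is the blowing-up of R^2 at
   the finitely many (distinct) points of S (a one-stage blowing-up). *)
Definition regular_after_blowup (S : list (R * R)) (f : R -> R -> R) : Prop :=
  (forall x y, ~ In (x, y) S -> regular_at f x y) /\
  (forall a, In a S ->
     (forall v, regular_at (chart1 a f) 0 v) /\
     (forall u, regular_at (chart2 a f) u 0)).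

Definition regulous_1 (k : nat) (f : R -> R -> R) : Prop :=
  regulous k f /\ exists S : list (R * R), regular_after_blowup S f.

(* Main.v *)
Require Import Defs.
From Stdlib Require Import Reals List Factorial Lra Lia Classical ClassicalEpsilon
  FunctionalExtensionality.
From Coquelicot Require Import Coquelicot.
Open Scope R_scope.

(** Let [g] have a regular pullback to the blowing-up of a point [(a, b)]. Then [g] is
    of class C^k at [(a, b)] if and only if there is a polynomial [T] such that the
    pullback of [g - T] is divisible by the (k+1)-st power of an equation of the
    exceptional divisor. Necessity: take for [T] the Taylor polynomial; the remainder
    is [o(u^k)] on each line through the point, which kills the first [k+1]
    coefficients in [u] of the numerator in the chart [(u, v)]. Sufficiency: a partial
    derivative lowers the order of vanishing along the divisor by at most one, and a
    function of positive order tends to [0] at the point, since the divisor is compact.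
    If [U] and [T] are such polynomials for [h] and [f], then
    [h f - U T = U (f - T) + (h - U) f]. At a pole of [f] we have [U a b = h a b = 0],
    so [U] contributes the one order of vanishing that [f - T] lacks; elsewhere [f] is
    smooth and [T] can be taken of order one more. *)

(** * Polynomial functions of two variables *)

Lemma is_poly2_ext (p q : R -> R -> R) :
  (forall x y, p x y = q x y) -> is_poly2 p -> is_poly2 q.
Proof.
intros E [n [c H]]; exists n, c; intros x y; rewrite <- E; apply H.
Qed.

Lemma sum_f_R0_truncate (F : nat -> R) (n N : nat) : (n <= N)%nat ->
  sum_f_R0 (fun i => if Nat.leb i n then F i else 0) N = sum_f_R0 F n.
Proof.
induction N as [|N IH]; intros H.
- assert (n = 0)%nat as -> by lia. reflexivity.
- destruct (Nat.eq_dec n (S N)) as [->|ne].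
  + apply sum_eq; intros i Hi.
    now rewrite (proj2 (Nat.leb_le i (S N)) Hi).
  + rewrite tech5, IH by lia.
    rewrite (proj2 (Nat.leb_gt (S N) n)) by lia. ring.
Qed.

(** Addition is done coefficient by coefficient, so both summands must first be indexed by the same
    square; the new coefficients are zero. *)
Lemma is_poly2_pad (p : R -> R -> R) (n N : nat) (c : nat -> nat -> R) :
  (n <= N)%nat ->
  (forall x y,
    p x y = sum_f_R0 (fun i => sum_f_R0 (fun j => c i j * x ^ i * y ^ j) n) n) ->
  exists c', forall x y,
    p x y = sum_f_R0 (fun i => sum_f_R0 (fun j => c' i j * x ^ i * y ^ j) N) N.
Proof.
intros nN H.
exists (fun i j => if Nat.leb i n then (if Nat.leb j n then c i j else 0) else 0).
intros x y; rewrite H, <- (sum_f_R0_truncate _ n N nN).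
apply sum_eq; intros i _; destruct (Nat.leb i n).
- rewrite <- (sum_f_R0_truncate _ n N nN).
  apply sum_eq; intros j _; destruct (Nat.leb j n); ring.
- symmetry; apply sum_eq_R0; intros; ring.
Qed.

Lemma is_poly2_plus (p q : R -> R -> R) :
  is_poly2 p -> is_poly2 q -> is_poly2 (fun x y => p x y + q x y).
Proof.
intros [n [c Hp]] [m [d Hq]].
destruct (is_poly2_pad p n (n + m) c ltac:(lia) Hp) as [c' Hp'].
destruct (is_poly2_pad q m (n + m) d ltac:(lia) Hq) as [d' Hq'].
exists (n + m)%nat, (fun i j => c' i j + d' i j); intros x y.
rewrite Hp', Hq', <- sum_plus; apply sum_eq; intros i _.
rewrite <- sum_plus; apply sum_eq; intros j _; ring.
Qed.

Lemma sum_f_R0_single (F : nat -> R) (k n : nat) : (k <= n)%nat ->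
  sum_f_R0 (fun i => if Nat.eqb i k then F i else 0) n = F k.
Proof.
induction n as [|n IH]; intros H.
- now assert (k = 0)%nat as -> by lia.
- rewrite tech5; destruct (Nat.eq_dec (S n) k) as [<-|ne].
  + rewrite Nat.eqb_refl, sum_eq_R0; [ring|].
    intros i Hi; now rewrite (proj2 (Nat.eqb_neq i (S n))) by lia.
  + rewrite IH by lia. rewrite (proj2 (Nat.eqb_neq (S n) k)) by lia. ring.
Qed.

Lemma is_poly2_monomial (a : R) (i j : nat) :
  is_poly2 (fun x y => a * x ^ i * y ^ j).
Proof.
exists (i + j)%nat,
  (fun i' j' => if Nat.eqb i' i then (if Nat.eqb j' j then a else 0) else 0).
intros x y.
transitivity (sum_f_R0 (fun i' => if Nat.eqb i' i then a * x ^ i' * y ^ j else 0)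
  (i + j)).
- rewrite sum_f_R0_single; [reflexivity | lia].
- apply sum_eq; intros i' _; destruct (Nat.eqb i' i).
  + transitivity (sum_f_R0
      (fun j' => if Nat.eqb j' j then a * x ^ i' * y ^ j' else 0) (i + j)).
    * rewrite sum_f_R0_single; [reflexivity | lia].
    * apply sum_eq; intros j' _; destruct (Nat.eqb j' j); ring.
  + symmetry; apply sum_eq_R0; intros; ring.
Qed.

Lemma is_poly2_sum (F : nat -> R -> R -> R) (n : nat) :
  (forall i, is_poly2 (F i)) ->
  is_poly2 (fun x y => sum_f_R0 (fun i => F i x y) n).
Proof.
intros H; induction n as [|n IH]; simpl; [apply H | now apply is_poly2_plus].
Qed.

Lemma is_poly2_mult (p q : R -> R -> R) :
  is_poly2 p -> is_poly2 q -> is_poly2 (fun x y => p x y * q x y).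
Proof.
intros [n [c Hp]] [m [d Hq]].
apply (is_poly2_ext (fun x y => sum_f_R0 (fun i => sum_f_R0 (fun j =>
  sum_f_R0 (fun i' => sum_f_R0 (fun j' =>
    c i j * d i' j' * x ^ (i + i') * y ^ (j + j')) m) m) n) n)).
- intros x y; rewrite Hp, Hq, Rmult_comm, scal_sum.
  apply sum_eq; intros i _; rewrite Rmult_comm, scal_sum.
  apply sum_eq; intros j _; rewrite scal_sum.
  apply sum_eq; intros i' _; rewrite Rmult_comm, scal_sum.
  apply sum_eq; intros j' _; rewrite !pow_add; ring.
- apply is_poly2_sum; intros i; apply is_poly2_sum; intros j.
  apply is_poly2_sum; intros i'; apply is_poly2_sum; intros j'.
  apply is_poly2_monomial.
Qed.

Lemma is_poly2_const (a : R) : is_poly2 (fun _ _ => a).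
Proof.
apply (is_poly2_ext (fun x y => a * x ^ 0 * y ^ 0)).
- intros; simpl; ring.
- apply is_poly2_monomial.
Qed.

Lemma is_poly2_fst : is_poly2 (fun x _ => x).
Proof.
apply (is_poly2_ext (fun x y => 1 * x ^ 1 * y ^ 0)).
- intros; simpl; ring.
- apply is_poly2_monomial.
Qed.

Lemma is_poly2_snd : is_poly2 (fun _ y => y).
Proof.
apply (is_poly2_ext (fun x y => 1 * x ^ 0 * y ^ 1)).
- intros; simpl; ring.
- apply is_poly2_monomial.
Qed.

Lemma is_poly2_minus (p q : R -> R -> R) :
  is_poly2 p -> is_poly2 q -> is_poly2 (fun x y => p x y - q x y).
Proof.
intros Hp Hq.
apply (is_poly2_ext (fun x y => p x y + (-1) * q x y)); [intros; ring|].
apply is_poly2_plus; [assumption|].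
apply is_poly2_mult; [apply is_poly2_const | assumption].
Qed.

Create HintDb poly2.
#[local] Hint Resolve is_poly2_plus is_poly2_minus is_poly2_mult is_poly2_const
  is_poly2_fst is_poly2_snd : poly2.

Lemma is_poly2_ind (P : (R -> R -> R) -> Prop) :
  (forall a, P (fun _ _ => a)) -> P (fun x _ => x) -> P (fun _ y => y) ->
  (forall p q, is_poly2 p -> is_poly2 q -> P p -> P q ->
    P (fun x y => p x y + q x y)) ->
  (forall p q, is_poly2 p -> is_poly2 q -> P p -> P q ->
    P (fun x y => p x y * q x y)) ->
  forall p, is_poly2 p -> P p.
Proof.
intros Pc Px Py Pp Pm p [n [c H]].
(* Polynomiality travels with [P], because the clauses for sums and products ask that both operands
   be polynomial. *)
set (Q := fun p => is_poly2 p /\ P p).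
assert (Qm : forall p q, Q p -> Q q -> Q (fun x y => p x y * q x y)).
{ intros p1 p2 [A1 B1] [A2 B2]; split; auto with poly2. }
assert (Qs : forall F m, (forall i, Q (F i)) ->
  Q (fun x y => sum_f_R0 (fun i => F i x y) m)).
{ intros F m HF; induction m as [|m [IA IB]]; simpl; [apply HF|].
  destruct (HF (S m)) as [A B]; split; auto with poly2. }
assert (Qx : forall i, Q (fun x _ => x ^ i)).
{ induction i as [|i IH]; simpl; [split; auto with poly2|].
  apply (Qm (fun x _ => x)); [split; auto with poly2 | exact IH]. }
assert (Qy : forall j, Q (fun _ y => y ^ j)).
{ induction j as [|j IH]; simpl; [split; auto with poly2|].
  apply (Qm (fun _ y => y)); [split; auto with poly2 | exact IH]. }
replace p with (fun x y =>
  sum_f_R0 (fun i => sum_f_R0 (fun j => c i j * x ^ i * y ^ j) n) n).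
- apply (Qs (fun i x y => sum_f_R0 (fun j => c i j * x ^ i * y ^ j) n)).
  intros i; apply (Qs (fun j x y => c i j * x ^ i * y ^ j)).
  intros j; apply (Qm (fun x y => c i j * x ^ i)); [|apply Qy].
  apply (Qm (fun _ _ => c i j)); [split; auto with poly2 | apply Qx].
- extensionality x; extensionality y; symmetry; apply H.
Qed.

Lemma is_poly2_comp (p q r : R -> R -> R) :
  is_poly2 p -> is_poly2 q -> is_poly2 r ->
  is_poly2 (fun x y => p (q x y) (r x y)).
Proof.
intros Hp Hq Hr; revert p Hp; apply is_poly2_ind; auto with poly2.
Qed.

Lemma is_poly2_continuous (p : R -> R -> R) (x y : R) :
  is_poly2 p -> continuity_2d_pt p x y.
Proof.
revert p; apply is_poly2_ind; intros.
- apply continuity_2d_pt_const.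
- apply continuity_2d_pt_id1.
- apply continuity_2d_pt_id2.
- now apply continuity_2d_pt_plus.
- now apply continuity_2d_pt_mult.
Qed.

(** * Derivatives of polynomials and division by the first coordinate *)

Lemma is_derive_eq (f : R -> R) (x l l' : R) :
  is_derive f x l -> l = l' -> is_derive f x l'.
Proof. now intros H <-. Qed.

Lemma is_derive_const_R (c x : R) : is_derive (fun _ : R => c) x 0.
Proof. apply (@is_derive_const R_AbsRing R_NormedModule). Qed.

Lemma is_derive_id_R (x : R) : is_derive (fun t : R => t) x 1.
Proof. apply (@is_derive_id R_AbsRing). Qed.

Lemma is_derive_plus_R (f g : R -> R) (x df dg : R) :
  is_derive f x df -> is_derive g x dg ->
  is_derive (fun t => f t + g t) x (df + dg).
Proof. apply (@is_derive_plus R_AbsRing R_NormedModule). Qed.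

Lemma is_derive_mult_R (f g : R -> R) (x df dg : R) :
  is_derive f x df -> is_derive g x dg ->
  is_derive (fun t => f t * g t) x (df * g x + f x * dg).
Proof.
intros Hf Hg; apply (@is_derive_mult R_AbsRing); auto; intros; apply Rmult_comm.
Qed.

(** Stating the chain rule along an arbitrary curve serves both the partial derivatives, where [s]
    or [t] is constant, and the curves that express chart coordinates through x or y. *)
Lemma is_poly2_derive (p : R -> R -> R) : is_poly2 p ->
  exists px py, is_poly2 px /\ is_poly2 py /\
    forall (s t : R -> R) (z ds dt : R), is_derive s z ds -> is_derive t z dt ->
      is_derive (fun w => p (s w) (t w)) z
        (px (s z) (t z) * ds + py (s z) (t z) * dt).
Proof.
revert p; apply is_poly2_ind.
- intros a; exists (fun _ _ => 0), (fun _ _ => 0).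
  split; [|split; [|intros]]; auto with poly2.
  apply (is_derive_eq _ _ 0); [apply is_derive_const_R | ring].
- exists (fun _ _ => 1), (fun _ _ => 0); split; [|split; [|intros]]; auto with poly2.
  apply (is_derive_eq _ _ ds); [assumption | ring].
- exists (fun _ _ => 0), (fun _ _ => 1); split; [|split; [|intros]]; auto with poly2.
  apply (is_derive_eq _ _ dt); [assumption | ring].
- intros p q Hp Hq (px & py & Hpx & Hpy & Dp) (qx & qy & Hqx & Hqy & Dq).
  exists (fun x y => px x y + qx x y), (fun x y => py x y + qy x y).
  split; [|split; [|intros]]; auto with poly2.
  eapply is_derive_eq.
  + apply is_derive_plus_R; [apply Dp | apply Dq]; eassumption.
  + simpl; ring.
- intros p q Hp Hq (px & py & Hpx & Hpy & Dp) (qx & qy & Hqx & Hqy & Dq).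
  exists (fun x y => px x y * q x y + p x y * qx x y),
    (fun x y => py x y * q x y + p x y * qy x y).
  split; [|split; [|intros]]; auto with poly2.
  eapply is_derive_eq.
  + apply is_derive_mult_R; [apply Dp | apply Dq]; eassumption.
  + simpl; ring.
Qed.

(** In a chart, x is an equation of the exceptional divisor. For a product, pq = p(0,y) q(0,y) + x
    (p1 q + p(0,y) q1). *)
Lemma is_poly2_factor_fst (p : R -> R -> R) : is_poly2 p ->
  exists p1, is_poly2 p1 /\ forall x y, p x y = p 0 y + x * p1 x y.
Proof.
revert p; apply is_poly2_ind.
- intros a; exists (fun _ _ => 0); split; auto with poly2; intros; ring.
- exists (fun _ _ => 1); split; auto with poly2; intros; ring.
- exists (fun _ _ => 0); split; auto with poly2; intros; ring.
- intros p q _ _ (p1 & Hp1 & Ep) (q1 & Hq1 & Eq).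
  exists (fun x y => p1 x y + q1 x y); split; auto with poly2.
  intros; rewrite Ep, Eq; ring.
- intros p q Hp Hq (p1 & Hp1 & Ep) (q1 & Hq1 & Eq).
  exists (fun x y => p1 x y * q x y + p 0 y * q1 x y); split.
  + apply is_poly2_plus; auto with poly2.
    apply is_poly2_mult; auto.
    apply (is_poly2_comp p (fun _ _ => 0)); auto with poly2.
  + intros; rewrite Ep, Eq; ring.
Qed.

(** * Differentiability classes at a point *)

Definition D1 (f : R -> R -> R) : R -> R -> R :=
  fun x y => Derive (fun t => f t y) x.
Definition D2 (f : R -> R -> R) : R -> R -> R :=
  fun x y => Derive (fun t => f x t) y.

(** A notion at a single point lets poles and regular points of f be treated by different arguments.
    As [Derive] is total, the existence of the partial derivatives is asked separately. *)
Fixpoint Ck_at (k : nat) (f : R -> R -> R) (x y : R) : Prop :=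
  match k with
  | O => continuity_2d_pt f x y
  | S k' => continuity_2d_pt f x y /\
      ex_derive (fun t => f t y) x /\ ex_derive (fun t => f x t) y /\
      Ck_at k' (D1 f) x y /\ Ck_at k' (D2 f) x y
  end.

Lemma Ck_at_continuous (k : nat) (f : R -> R -> R) (x y : R) :
  Ck_at k f x y -> continuity_2d_pt f x y.
Proof. destruct k; simpl; tauto. Qed.

Lemma cont2_iff (f : R -> R -> R) :
  cont2 f <-> forall x y, continuity_2d_pt f x y.
Proof.
split.
- intros H x y eps; destruct (H x y eps (cond_pos eps)) as (d & d0 & Hd).
  exists (mkposreal d d0); exact Hd.
- intros H x y eps e0; destruct (H x y (mkposreal eps e0)) as (d & Hd).
  exists d; split; [apply cond_pos | exact Hd].
Qed.

Lemma Ck2_iff (k : nat) (f : R -> R -> R) :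
  Ck2 k f <-> forall x y, Ck_at k f x y.
Proof.
revert f; induction k as [|k IH]; intros f; simpl; [apply cont2_iff|].
split.
- intros (C & fx & fy & Hx & Hy & Cx & Cy) x y.
  assert (fx = D1 f) as ->.
  { extensionality u; extensionality v; symmetry.
    apply is_derive_unique, is_derive_Reals, Hx. }
  assert (fy = D2 f) as ->.
  { extensionality u; extensionality v; symmetry.
    apply is_derive_unique, is_derive_Reals, Hy. }
  repeat split.
  + now apply cont2_iff.
  + eexists; apply is_derive_Reals, Hx.
  + eexists; apply is_derive_Reals, Hy.
  + now apply IH.
  + now apply IH.
- intros H; split; [apply cont2_iff; apply H|].
  exists (D1 f), (D2 f); repeat split.
  + intros x y; apply is_derive_Reals, Derive_correct, (proj1 (proj2 (H x y))).
  + intros x y; apply is_derive_Reals, Derive_correct.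
    apply (proj1 (proj2 (proj2 (H x y)))).
  + apply IH; intros; apply H.
  + apply IH; intros; apply H.
Qed.

Lemma locally_2d_open (P : R -> R -> Prop) (x y : R) :
  locally_2d P x y -> locally_2d (locally_2d P) x y.
Proof.
intros H; apply locally_2d_impl_strong with (2 := H).
now apply locally_2d_forall.
Qed.

(** Induction by the quotient rule: near the point the partial derivatives are again quotients of
    polynomials, now over q^2. For this [f] need only agree with p/q locally. *)
Lemma rational_Ck_at (k : nat) (p q f : R -> R -> R) (x y : R) :
  is_poly2 p -> is_poly2 q -> q x y <> 0 ->
  locally_2d (fun u v => f u v = p u v / q u v) x y -> Ck_at k f x y.
Proof.
revert p q f x y; induction k as [|k IH]; intros p q f x y Hp Hq q0 E;
  assert (C : continuity_2d_pt f x y).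
1,3: apply (continuity_2d_pt_ext_loc (fun u v => p u v * / q u v));
  [apply locally_2d_impl with (2 := E); apply locally_2d_forall; auto |];
  apply continuity_2d_pt_mult; [|apply continuity_2d_pt_inv; auto];
  now apply is_poly2_continuous.
- exact C.
- destruct (is_poly2_derive p Hp) as (px & py & Hpx & Hpy & Dp).
  destruct (is_poly2_derive q Hq) as (qx & qy & Hqx & Hqy & Dq).
  assert (L : locally_2d (fun u v =>
    is_derive (fun t => f t v) u
      ((px u v * q u v - p u v * qx u v) / (q u v * q u v)) /\
    is_derive (fun t => f u t) v
      ((py u v * q u v - p u v * qy u v) / (q u v * q u v))) x y).
  { assert (N := continuity_2d_pt_neq_0 q x y (is_poly2_continuous q x y Hq) q0).
    generalize (locally_2d_and _ _ _ _ N (locally_2d_open _ _ _ E)).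
    apply locally_2d_impl, locally_2d_forall; intros u v [n L]; split.
    - apply (is_derive_ext_loc (fun t => p t v / q t v)).
      + apply locally_2d_1d_const_y in L.
        apply filter_imp with (2 := L); intros t Ht; symmetry; exact Ht.
      + eapply is_derive_eq; [apply is_derive_div; [| |exact n]|].
        * apply (Dp (fun t => t) (fun _ => v));
          [apply is_derive_id_R | apply is_derive_const_R].
        * apply (Dq (fun t => t) (fun _ => v));
          [apply is_derive_id_R | apply is_derive_const_R].
        * simpl; field; exact n.
    - apply (is_derive_ext_loc (fun t => p u t / q u t)).
      + apply locally_2d_1d_const_x in L.
        apply filter_imp with (2 := L); intros t Ht; symmetry; exact Ht.
      + eapply is_derive_eq; [apply is_derive_div; [| |exact n]|].
        * apply (Dp (fun _ => u) (fun t => t));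
          [apply is_derive_const_R | apply is_derive_id_R].
        * apply (Dq (fun _ => u) (fun t => t));
          [apply is_derive_const_R | apply is_derive_id_R].
        * simpl; field; exact n. }
  destruct (locally_2d_singleton _ _ _ L) as [L1 L2].
  split; [exact C|]; split; [eexists; exact L1|]; split; [eexists; exact L2|].
  split.
  + apply (IH (fun u v => px u v * q u v - p u v * qx u v)
      (fun u v => q u v * q u v)).
    * auto with poly2.
    * auto with poly2.
    * now apply Rmult_integral_contrapositive_currified.
    * apply locally_2d_impl with (2 := L); apply locally_2d_forall.
      intros u v [A _]; now apply is_derive_unique.
  + apply (IH (fun u v => py u v * q u v - p u v * qy u v)
      (fun u v => q u v * q u v)).
    * auto with poly2.
    * auto with poly2.
    * now apply Rmult_integral_contrapositive_currified.
    * apply locally_2d_impl with (2 := L); apply locally_2d_forall.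
      intros u v [_ A]; now apply is_derive_unique.
Qed.

Lemma regular_at_Ck_at (k : nat) (f : R -> R -> R) (x y : R) :
  regular_at f x y -> locally_2d (Ck_at k f) x y.
Proof.
intros (p & q & Hp & Hq & q0 & E).
assert (N := continuity_2d_pt_neq_0 q x y (is_poly2_continuous q x y Hq) q0).
apply locally_2d_impl_strong with (2 := N); apply locally_2d_forall.
intros u v L; apply (rational_Ck_at k p q); auto.
- apply (locally_2d_singleton _ _ _ L).
- apply locally_2d_impl with (2 := L), locally_2d_forall; auto.
Qed.

(** * Order of vanishing along the exceptional divisor *)

Lemma locally_2d_comp (P : R -> R -> Prop) (s t : R -> R) (z ds dt : R) :
  is_derive s z ds -> is_derive t z dt -> locally_2d P (s z) (t z) ->
  locally z (fun w => P (s w) (t w)).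
Proof.
intros Hs Ht [d Hd].
assert (Cs : continuous s z).
{ apply (@ex_derive_continuous R_AbsRing R_NormedModule); eexists; exact Hs. }
assert (Ct : continuous t z).
{ apply (@ex_derive_continuous R_AbsRing R_NormedModule); eexists; exact Ht. }
assert (Ls : locally z (fun w => ball (s z) d (s w))) by apply Cs, locally_ball.
assert (Lt : locally z (fun w => ball (t z) d (t w))) by apply Ct, locally_ball.
generalize (filter_and _ _ Ls Lt).
apply filter_imp; intros w [A B]; apply Hd; [exact A | exact B].
Qed.

(* In the chart (u, v) of the blowing-up of (a, b), the pullback of [g] is [u ^ m]
   times a regular function near every point of the exceptional line, except that
   nothing is required on that line itself. *)
Definition chart_order (m : nat) (g : R -> R -> R) (a b : R) : Prop :=
  forall v0, exists p q, is_poly2 p /\ is_poly2 q /\ q 0 v0 <> 0 /\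
    locally_2d (fun u v => q u v <> 0 /\
      (u <> 0 -> g (a + u) (b + u * v) = u ^ m * (p u v / q u v))) 0 v0.

Definition swap (g : R -> R -> R) : R -> R -> R := fun x y => g y x.

(** The second chart of g at (a, b) is the first chart of [swap g] at (b, a), up to exchanging its
    coordinates. Local computations are thus made in one chart only. *)
Definition blowup_order (m : nat) (g : R -> R -> R) (a b : R) : Prop :=
  chart_order m g a b /\ chart_order m (swap g) b a.

Lemma chart_order_intro (m : nat) (g : R -> R -> R) (a b : R) :
  (forall v0, exists p q, is_poly2 p /\ is_poly2 q /\ q 0 v0 <> 0 /\
    locally_2d (fun u v => u <> 0 -> q u v <> 0 ->
      g (a + u) (b + u * v) = u ^ m * (p u v / q u v)) 0 v0) ->
  chart_order m g a b.
Proof.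
intros H v0; destruct (H v0) as (p & q & Hp & Hq & q0 & L).
exists p, q; split; [|split; [|split]]; auto.
generalize (locally_2d_and _ _ _ _ L
  (continuity_2d_pt_neq_0 q 0 v0 (is_poly2_continuous q 0 v0 Hq) q0)).
apply locally_2d_impl, locally_2d_forall; intros u v [A B]; auto.
Qed.

(** Off the divisor the condition u <> 0 is open, so the formula holds on a whole neighbourhood and
    may be differentiated. *)
Lemma chart_order_locally_rational (m : nat) (g p q : R -> R -> R) (a b u v : R) :
  u <> 0 ->
  locally_2d (fun u v => q u v <> 0 /\
    (u <> 0 -> g (a + u) (b + u * v) = u ^ m * (p u v / q u v))) u v ->
  locally_2d (fun u v => g (a + u) (b + u * v) = u ^ m * (p u v / q u v)) u v.
Proof.
intros u0 L.
generalize (locally_2d_and _ _ _ _ L (continuity_2d_pt_neq_0 (fun u _ => u) u v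
  (continuity_2d_pt_id1 u v) u0)).
apply locally_2d_impl, locally_2d_forall; intros s w [[_ A] B]; auto.
Qed.

(** With s = x - a and w = (y - b)/(x - a), one differentiates s^(m+1) (p/q)(s, w) in x. Since dw/dx
    = -w/s, only one factor s is lost. The hypothesis on [g'] asks for nothing where the derivative
    fails to exist, so a function built from [D1] can be used. *)
Lemma chart_order_derive1 (m : nat) (g g' : R -> R -> R) (a b : R) :
  chart_order (S m) g a b ->
  (forall x y d, is_derive (fun t => g t y) x d -> g' x y = d) ->
  chart_order m g' a b.
Proof.
intros H Hg; apply chart_order_intro; intros v0.
destruct (H v0) as (p & q & Hp & Hq & q0 & L).
destruct (is_poly2_derive p Hp) as (px & py & Hpx & Hpy & Dp).
destruct (is_poly2_derive q Hq) as (qx & qy & Hqx & Hqy & Dq).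
(* This is q^2 times (m+1) F + u F_u - v F_v, where F = p/q. *)
exists (fun u v => INR (S m) * (p u v * q u v)
    + u * (px u v * q u v - p u v * qx u v)
    - v * (py u v * q u v - p u v * qy u v)), (fun u v => q u v * q u v).
split; [auto 10 with poly2|]; split; [auto with poly2|].
split; [now apply Rmult_integral_contrapositive_currified|].
generalize (locally_2d_open _ _ _ L).
apply locally_2d_impl, locally_2d_forall; intros u v Luv u0 _.
assert (n := proj1 (locally_2d_singleton _ _ _ Luv)).
apply (chart_order_locally_rational _ _ _ _ _ _ _ _ u0) in Luv.
(* Chart coordinates of the point (t, b + u v), which runs along a horizontal line. *)
set (s := fun t : R => t - a); set (w := fun t : R => u * v / (t - a)).
assert (su : s (a + u) = u) by (unfold s; ring).
assert (wv : w (a + u) = v) by (unfold w; field; lra).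
assert (Ds : is_derive s (a + u) 1) by (unfold s; auto_derive; [auto | ring]).
assert (Dw : is_derive w (a + u) (- v / u)).
{ unfold w; auto_derive; [lra | field; lra]. }
apply Hg, (is_derive_ext_loc (fun t => s t ^ S m * (p (s t) (w t) / q (s t) (w t)))).
- rewrite <- su, <- wv in Luv.
  assert (Lt := locally_2d_comp _ _ _ _ _ _ Ds Dw Luv).
  assert (Ln := locally_2d_comp _ _ _ _ _ _ Ds Dw
    (continuity_2d_pt_neq_0 (fun u _ => u) _ _ (continuity_2d_pt_id1 _ _)
      (eq_ind_r (fun z => z <> 0) u0 su))).
  generalize (filter_and _ _ Lt Ln); apply filter_imp; intros t [A B].
  rewrite <- A; unfold s, w in *; f_equal; [ring | field; auto].
- eapply is_derive_eq.
  + apply is_derive_mult_R; [apply is_derive_pow, Ds|].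
    apply is_derive_div; [apply Dp; eassumption | apply Dq; eassumption|].
    rewrite su, wv; exact n.
  + cbv beta; rewrite su, wv; change (Nat.pred (S m)) with m.
    rewrite <- (tech_pow_Rmult u m); field; auto.
Qed.

(** On a vertical line u is constant and v = (y - b)/u has derivative 1/u, which costs one factor
    u. *)
Lemma chart_order_derive2 (m : nat) (g g' : R -> R -> R) (a b : R) :
  chart_order (S m) g a b ->
  (forall x y d, is_derive (fun t => g x t) y d -> g' x y = d) ->
  chart_order m g' a b.
Proof.
intros H Hg; apply chart_order_intro; intros v0.
destruct (H v0) as (p & q & Hp & Hq & q0 & L).
destruct (is_poly2_derive p Hp) as (px & py & Hpx & Hpy & Dp).
destruct (is_poly2_derive q Hq) as (qx & qy & Hqx & Hqy & Dq).
exists (fun u v => py u v * q u v - p u v * qy u v), (fun u v => q u v * q u v).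
split; [auto with poly2|]; split; [auto with poly2|].
split; [now apply Rmult_integral_contrapositive_currified|].
generalize (locally_2d_open _ _ _ L).
apply locally_2d_impl, locally_2d_forall; intros u v Luv u0 _.
assert (n := proj1 (locally_2d_singleton _ _ _ Luv)).
apply (chart_order_locally_rational _ _ _ _ _ _ _ _ u0) in Luv.
set (s := fun t : R => u); set (w := fun t : R => (t - b) / u).
assert (wv : w (b + u * v) = v) by (unfold w; field; lra).
assert (Ds : is_derive s (b + u * v) 0) by apply is_derive_const_R.
assert (Dw : is_derive w (b + u * v) (/ u)).
{ unfold w; auto_derive; [auto | field; lra]. }
apply Hg, (is_derive_ext_loc (fun t => u ^ S m * (p (s t) (w t) / q (s t) (w t)))).
- rewrite <- wv in Luv.
  generalize (locally_2d_comp _ s w _ _ _ Ds Dw Luv); apply filter_imp; intros t A.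
  transitivity (g (a + s t) (b + s t * w t)); [symmetry; exact A|].
  unfold s, w; f_equal; field; auto.
- eapply is_derive_eq.
  + apply is_derive_mult_R; [apply is_derive_const_R|].
    apply is_derive_div; [apply Dp; eassumption | apply Dq; eassumption|].
    rewrite wv; exact n.
  + cbv beta; rewrite wv; unfold s; rewrite <- (tech_pow_Rmult u m); field; auto.
Qed.

(** Swapping turns the derivative in x into one in y, so each chart uses a different one of the two
    preceding computations. *)
Lemma blowup_order_derive1 (m : nat) (g g' : R -> R -> R) (a b : R) :
  blowup_order (S m) g a b ->
  (forall x y d, is_derive (fun t => g t y) x d -> g' x y = d) ->
  blowup_order m g' a b.
Proof.
intros [H1 H2] Hg; split.
- now apply (chart_order_derive1 m g).
- apply (chart_order_derive2 m (swap g)); [exact H2|].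
  intros x y d Hd; apply Hg, Hd.
Qed.

Lemma blowup_order_derive2 (m : nat) (g g' : R -> R -> R) (a b : R) :
  blowup_order (S m) g a b ->
  (forall x y d, is_derive (fun t => g x t) y d -> g' x y = d) ->
  blowup_order m g' a b.
Proof.
intros [H1 H2] Hg; split.
- now apply (chart_order_derive2 m g).
- apply (chart_order_derive1 m (swap g)); [exact H2|].
  intros x y d Hd; apply Hg, Hd.
Qed.

(* Compactness of the segment [-1, 1] of directions makes the bound uniform. *)
Lemma chart_order_small (m : nat) (g : R -> R -> R) (a b eps : R) :
  chart_order (S m) g a b -> 0 < eps ->
  exists d, 0 < d /\ forall u v, u <> 0 -> Rabs u < d -> -1 <= v <= 1 ->
    Rabs (g (a + u) (b + u * v)) < eps.
Proof.
intros H e0.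
assert (L : forall v0, exists d : posreal, forall u v,
  Rabs (u - 0) < d -> Rabs (v - v0) < d -> u <> 0 ->
  Rabs (g (a + u) (b + u * v)) < eps).
{ intros v0; destruct (H v0) as (p & q & Hp & Hq & q0 & L).
  assert (C : continuity_2d_pt (fun u v => u * (u ^ m * (p u v * / q u v))) 0 v0).
  { apply continuity_2d_pt_mult; [apply continuity_2d_pt_id1|].
    apply continuity_2d_pt_mult.
    - apply (continuity_1d_2d_pt_comp (fun z => z ^ m) (fun u _ => u)).
      + apply derivable_continuous_pt, derivable_pt_pow.
      + apply continuity_2d_pt_id1.
    - apply continuity_2d_pt_mult; [now apply is_poly2_continuous|].
      apply continuity_2d_pt_inv; [now apply is_poly2_continuous | exact q0]. }
  generalize (locally_2d_and _ _ _ _ L (C (mkposreal eps e0))).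
  apply locally_2d_impl, locally_2d_forall; intros u v [[n E] B] u0.
  rewrite E by exact u0; simpl in B |- *.
  rewrite Rmult_0_l, Rminus_0_r in B.
  unfold Rdiv; rewrite Rmult_assoc; exact B. }
(* [compactness_value_1d] expects a gauge, hence the choice of one radius per direction. Its
   conclusion is doubly negated, whence [NNPP] below. *)
assert (D : exists delta : R -> posreal, forall v0 u v,
  Rabs (u - 0) < delta v0 -> Rabs (v - v0) < delta v0 -> u <> 0 ->
  Rabs (g (a + u) (b + u * v)) < eps).
{ exists (fun v0 => proj1_sig (constructive_indefinite_description _ (L v0))).
  intros v0; apply (proj2_sig (constructive_indefinite_description _ (L v0))). }
destruct D as [delta Hd].
destruct (compactness_value_1d (-1) 1 delta) as [d Hc].
exists d; split; [apply cond_pos|]; intros u v u0 ud v1.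
apply NNPP; intros N; apply (Hc v v1); intros (t & _ & A & B).
apply N, (Hd t); auto; rewrite Rminus_0_r; lra.
Qed.

(** * From order of vanishing to class C^k *)

Lemma blowup_order_continuous (m : nat) (g : R -> R -> R) (a b : R) :
  blowup_order (S m) g a b -> g a b = 0 -> continuity_2d_pt g a b.
Proof.
intros [H1 H2] g0 eps.
destruct (chart_order_small m g a b eps H1 (cond_pos eps)) as (d1 & p1 & B1).
destruct (chart_order_small m (swap g) b a eps H2 (cond_pos eps)) as (d2 & p2 & B2).
exists (mkposreal _ (Rmin_pos _ _ p1 p2)); simpl; intros x y hx hy.
assert (x1 := Rlt_le_trans _ _ _ hx (Rmin_l d1 d2)).
assert (y2 := Rlt_le_trans _ _ _ hy (Rmin_r d1 d2)).
rewrite g0, Rminus_0_r.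
assert (Q : forall s t, t <> 0 -> Rabs s <= Rabs t -> -1 <= s / t <= 1).
{ intros s t t0 st; apply Rabs_le_between; unfold Rdiv.
  rewrite Rabs_mult, Rabs_inv.
  apply (Rmult_le_reg_r (Rabs t)); [now apply Rabs_pos_lt|].
  rewrite Rmult_assoc, Rinv_l by now apply Rabs_no_R0. lra. }
(* Slopes of absolute value at most one are seen in the first chart, the others in the second; so in
   each chart v stays in [-1, 1]. *)
destruct (Rle_dec (Rabs (y - b)) (Rabs (x - a))) as [le|nle].
- destruct (Req_dec (x - a) 0) as [z|nz].
  + rewrite z, Rabs_R0 in le.
    assert (y - b = 0).
    { destruct (Req_dec (y - b) 0) as [|n]; auto.
      apply Rabs_pos_lt in n; lra. }
    replace x with a by lra; replace y with b by lra.
    rewrite g0, Rabs_R0; apply cond_pos.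
  + specialize (B1 (x - a) ((y - b) / (x - a)) nz x1 (Q _ _ nz le)).
    replace (a + (x - a)) with x in B1 by ring.
    replace (b + (x - a) * ((y - b) / (x - a))) with y in B1 by (field; auto).
    exact B1.
- assert (nz : y - b <> 0).
  { intros z; rewrite z, Rabs_R0 in nle; apply nle, Rabs_pos. }
  assert (le : Rabs (x - a) <= Rabs (y - b)) by lra.
  specialize (B2 (y - b) ((x - a) / (y - b)) nz y2 (Q _ _ nz le)).
  replace (b + (y - b)) with y in B2 by ring.
  replace (a + (y - b) * ((x - a) / (y - b))) with x in B2 by (field; auto).
  exact B2.
Qed.

(** The horizontal line through the centre is v = 0, and there g is (t - a)^(m+2) times a
    differentiable function. At t = a itself the order says nothing, which is why the value g(a, b)
    = 0 is supplied. *)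
Lemma chart_order_is_derive (m : nat) (g : R -> R -> R) (a b : R) :
  chart_order (S (S m)) g a b -> g a b = 0 -> is_derive (fun t => g t b) a 0.
Proof.
intros H g0; destruct (H 0) as (p & q & Hp & Hq & q0 & L).
destruct (is_poly2_derive p Hp) as (px & py & _ & _ & Dp).
destruct (is_poly2_derive q Hq) as (qx & qy & _ & _ & Dq).
set (s := fun t : R => t - a); set (w := fun t : R => 0).
assert (s0 : s a = 0) by (unfold s; ring).
assert (Ds : is_derive s a 1) by (unfold s; auto_derive; [auto | ring]).
assert (Dw : is_derive w a 0) by apply is_derive_const_R.
apply (is_derive_ext_loc (fun t => s t ^ S (S m) * (p (s t) (w t) / q (s t) (w t)))).
- rewrite <- s0 in L at 1.
  generalize (locally_2d_comp _ s w _ _ _ Ds Dw L).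
  apply filter_imp; intros t [n A].
  destruct (Req_dec (s t) 0) as [z|nz].
  + rewrite z; replace t with a by (unfold s in z; lra); rewrite g0.
    simpl; ring.
  + rewrite <- (A nz); unfold s, w; f_equal; ring.
- eapply is_derive_eq.
  + apply is_derive_mult_R; [apply is_derive_pow, Ds|].
    apply is_derive_div; [apply Dp; eassumption | apply Dq; eassumption|].
    rewrite s0; exact q0.
  + cbv beta; rewrite s0; simpl; ring.
Qed.

Lemma blowup_order_ext (m : nat) (g g' : R -> R -> R) (a b : R) :
  (forall x y, g x y = g' x y) -> blowup_order m g a b -> blowup_order m g' a b.
Proof.
intros E; replace g' with g; auto.
extensionality x; extensionality y; apply E.
Qed.

(** Induction on k, with the partial derivatives of T as the polynomials for those of g. The order
    drops by one, and the derivatives of g - T vanish at the centre, so the condition on values is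
    inherited too. *)
Lemma blowup_order_Ck_at (k : nat) (g T : R -> R -> R) (a b : R) :
  is_poly2 T -> blowup_order (S k) (fun x y => g x y - T x y) a b ->
  g a b = T a b -> Ck_at k g a b.
Proof.
revert g T; induction k as [|k IH]; intros g T HT Hg E;
  assert (C : continuity_2d_pt g a b).
1,3: apply (continuity_2d_pt_ext (fun x y => (g x y - T x y) + T x y));
  [intros; ring|]; apply continuity_2d_pt_plus;
  [eapply blowup_order_continuous; [exact Hg | lra]|];
  now apply is_poly2_continuous.
- exact C.
- destruct (is_poly2_derive T HT) as (Tx & Ty & HTx & HTy & DT).
  assert (T1 : forall x y, is_derive (fun t => T t y) x (Tx x y)).
  { intros x y; eapply is_derive_eq;
      [apply (DT (fun t => t) (fun _ => y));
        [apply is_derive_id_R | apply is_derive_const_R] | simpl; ring]. }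
  assert (T2 : forall x y, is_derive (fun t => T x t) y (Ty x y)).
  { intros x y; eapply is_derive_eq;
      [apply (DT (fun _ => x) (fun t => t));
        [apply is_derive_const_R | apply is_derive_id_R] | simpl; ring]. }
  assert (G1 : forall x y d, is_derive (fun t => g t y - T t y) x d ->
    is_derive (fun t => g t y) x (d + Tx x y)).
  { intros x y d Hd; apply (is_derive_ext (fun t => (g t y - T t y) + T t y));
      [intros t; change (g t y - T t y + T t y = g t y :> R); ring|].
    now apply is_derive_plus_R. }
  assert (G2 : forall x y d, is_derive (fun t => g x t - T x t) y d ->
    is_derive (fun t => g x t) y (d + Ty x y)).
  { intros x y d Hd; apply (is_derive_ext (fun t => (g x t - T x t) + T x t));
      [intros t; change (g x t - T x t + T x t = g x t :> R); ring|].
    now apply is_derive_plus_R. }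
  assert (z1 := G1 _ _ _ (chart_order_is_derive k _ a b (proj1 Hg)
    (Rminus_diag_eq _ _ E))).
  assert (z2 := G2 _ _ _ (chart_order_is_derive k _ b a (proj2 Hg)
    (Rminus_diag_eq _ _ E))).
  split; [exact C|]; split; [eexists; exact z1|]; split; [eexists; exact z2|].
  split.
  + apply (IH _ Tx HTx).
    * apply (blowup_order_derive1 _ _ _ _ _ Hg); intros x y d Hd.
      assert (E' : D1 g x y = d + Tx x y) by apply is_derive_unique, G1, Hd.
      rewrite E'; ring.
    * assert (E' : D1 g a b = 0 + Tx a b) by apply is_derive_unique, z1.
      rewrite E'; ring.
  + apply (IH _ Ty HTy).
    * apply (blowup_order_derive2 _ _ _ _ _ Hg); intros x y d Hd.
      assert (E' : D2 g x y = d + Ty x y) by apply is_derive_unique, G2, Hd.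
      rewrite E'; ring.
    * assert (E' : D2 g a b = 0 + Ty a b) by apply is_derive_unique, z2.
      rewrite E'; ring.
Qed.

(** * Orders of sums, products and polynomials *)

Lemma chart_order_plus (m : nat) (f g : R -> R -> R) (a b : R) :
  chart_order m f a b -> chart_order m g a b ->
  chart_order m (fun x y => f x y + g x y) a b.
Proof.
intros Hf Hg; apply chart_order_intro; intros v0.
destruct (Hf v0) as (p1 & q1 & Hp1 & Hq1 & n1 & L1).
destruct (Hg v0) as (p2 & q2 & Hp2 & Hq2 & n2 & L2).
exists (fun u v => p1 u v * q2 u v + p2 u v * q1 u v), (fun u v => q1 u v * q2 u v).
split; [auto with poly2|]; split; [auto with poly2|].
split; [now apply Rmult_integral_contrapositive_currified|].
generalize (locally_2d_and _ _ _ _ L1 L2).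
apply locally_2d_impl, locally_2d_forall; intros u v [[m1 E1] [m2 E2]] u0 _.
rewrite E1, E2 by exact u0; field; auto.
Qed.

Lemma chart_order_mult (m n : nat) (f g : R -> R -> R) (a b : R) :
  chart_order m f a b -> chart_order n g a b ->
  chart_order (m + n) (fun x y => f x y * g x y) a b.
Proof.
intros Hf Hg; apply chart_order_intro; intros v0.
destruct (Hf v0) as (p1 & q1 & Hp1 & Hq1 & n1 & L1).
destruct (Hg v0) as (p2 & q2 & Hp2 & Hq2 & n2 & L2).
exists (fun u v => p1 u v * p2 u v), (fun u v => q1 u v * q2 u v).
split; [auto with poly2|]; split; [auto with poly2|].
split; [now apply Rmult_integral_contrapositive_currified|].
generalize (locally_2d_and _ _ _ _ L1 L2).
apply locally_2d_impl, locally_2d_forall; intros u v [[m1 E1] [m2 E2]] u0 _.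
rewrite E1, E2, pow_add by exact u0; field; auto.
Qed.

Lemma blowup_order_plus (m : nat) (f g : R -> R -> R) (a b : R) :
  blowup_order m f a b -> blowup_order m g a b ->
  blowup_order m (fun x y => f x y + g x y) a b.
Proof.
intros [A1 A2] [B1 B2]; split; [now apply chart_order_plus|].
now apply (chart_order_plus m (swap f) (swap g)).
Qed.

Lemma blowup_order_mult (m n : nat) (f g : R -> R -> R) (a b : R) :
  blowup_order m f a b -> blowup_order n g a b ->
  blowup_order (m + n) (fun x y => f x y * g x y) a b.
Proof.
intros [A1 A2] [B1 B2]; split; [now apply chart_order_mult|].
now apply (chart_order_mult m n (swap f) (swap g)).
Qed.

(** The whole line u = 0 is mapped to (a, b), so the pullback of T vanishes on it and is divisible
    by u. *)
Lemma chart_order_poly_root (T : R -> R -> R) (a b : R) :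
  is_poly2 T -> T a b = 0 -> chart_order 1 T a b.
Proof.
intros HT T0; apply chart_order_intro; intros v0.
destruct (is_poly2_factor_fst (fun u v => T (a + u) (b + u * v))) as (p & Hp & E).
{ apply (is_poly2_comp T (fun u v => a + u) (fun u v => b + u * v)); auto with poly2. }
exists p, (fun _ _ => 1); split; [exact Hp|]; split; [auto with poly2|].
split; [apply R1_neq_R0|]; apply locally_2d_forall; intros u v _ _.
rewrite E, Rmult_0_l, !Rplus_0_r, T0; field.
Qed.

Lemma is_poly2_swap (p : R -> R -> R) : is_poly2 p -> is_poly2 (swap p).
Proof.
intros H; apply (is_poly2_comp p (fun _ y => y) (fun x _ => x)); auto with poly2.
Qed.

Lemma blowup_order_poly_root (T : R -> R -> R) (a b : R) :
  is_poly2 T -> T a b = 0 -> blowup_order 1 T a b.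
Proof.
intros HT T0; split; apply chart_order_poly_root; auto using is_poly2_swap.
Qed.

(** * Taylor expansion along lines *)

(** This is (u D1 + w D2)^i g at (a, b), expanded with the order of differentiation kept, so that no
    symmetry of mixed derivatives is invoked. *)
Fixpoint directional (i : nat) (g : R -> R -> R) (a b u w : R) : R :=
  match i with
  | O => g a b
  | S i' => u * directional i' (D1 g) a b u w + w * directional i' (D2 g) a b u w
  end.

Definition taylor (k : nat) (g : R -> R -> R) (a b u w : R) : R :=
  sum_f_R0 (fun i => directional i g a b u w * / INR (fact i)) k.

Lemma directional_homogeneous (i : nat) (g : R -> R -> R) (a b u v : R) :
  directional i g a b u (u * v) = u ^ i * directional i g a b 1 v.
Proof.
revert g; induction i as [|i IH]; intros g; simpl; [ring|].
rewrite !IH; ring.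
Qed.

Lemma is_poly2_directional (i : nat) (g : R -> R -> R) (a b : R) :
  is_poly2 (directional i g a b).
Proof.
revert g; induction i as [|i IH]; intros g; simpl; auto with poly2.
Qed.

Lemma is_poly2_taylor (k : nat) (g : R -> R -> R) (a b : R) :
  is_poly2 (taylor k g a b).
Proof.
apply (is_poly2_sum (fun i u w => directional i g a b u w * / INR (fact i))).
intros i; apply is_poly2_mult; [apply is_poly2_directional | apply is_poly2_const].
Qed.

Lemma taylor_center (k : nat) (g : R -> R -> R) (a b : R) :
  taylor k g a b 0 0 = g a b.
Proof.
unfold taylor; induction k as [|k IH]; [simpl; field|].
rewrite tech5, IH; simpl directional; ring.
Qed.

(** Taylor polynomials obey the same chain rule along a line as g itself. Hence the derivative of
    the remainder of g is a combination of the remainders of [D1 g] and [D2 g]. *)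
Lemma is_derive_taylor_line (k : nat) (g : R -> R -> R) (a b u v : R) :
  is_derive (fun u => taylor (S k) g a b u (u * v)) u
    (taylor k (D1 g) a b u (u * v) + v * taylor k (D2 g) a b u (u * v)).
Proof.
assert (step : forall i, is_derive
  (fun u => directional (S i) g a b u (u * v) * / INR (fact (S i))) u
  (directional i (D1 g) a b u (u * v) * / INR (fact i)
    + v * (directional i (D2 g) a b u (u * v) * / INR (fact i)))).
{ intros i.
  apply (is_derive_ext
    (fun u => u ^ S i * (directional (S i) g a b 1 v * / INR (fact (S i))))).
  { intros t; rewrite directional_homogeneous, Rmult_assoc; reflexivity. }
  eapply is_derive_eq.
  - apply is_derive_mult_R; [apply is_derive_pow, is_derive_id_R|].
    apply is_derive_const_R.
  - cbv beta; rewrite !directional_homogeneous.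
    change (Nat.pred (S i)) with i.
    rewrite fact_simpl, mult_INR; simpl directional.
    field; split; [apply INR_fact_neq_0 | now apply not_0_INR]. }
unfold taylor; induction k as [|k IH].
- apply (is_derive_ext (fun u => g a b * / 1 +
    directional 1 g a b u (u * v) * / INR (fact 1))); [reflexivity|].
  eapply is_derive_eq.
  + apply is_derive_plus_R; [apply is_derive_const_R | apply step].
  + simpl; ring.
- apply (is_derive_ext (fun u =>
    sum_f_R0 (fun i => directional i g a b u (u * v) * / INR (fact i)) (S k)
    + directional (S (S k)) g a b u (u * v) * / INR (fact (S (S k)))));
    [reflexivity|].
  eapply is_derive_eq.
  + apply is_derive_plus_R; [apply IH | apply step].
  + rewrite !(tech5 _ k); ring.
Qed.

(** The neighbourhood gives the first partial derivative around the point; with its continuity there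
    and the second partial derivative at the point, g is differentiable. *)
Lemma Ck_at_chain (k : nat) (g : R -> R -> R) (s t : R -> R) (z ds dt : R) :
  locally_2d (Ck_at (S k) g) (s z) (t z) -> is_derive s z ds -> is_derive t z dt ->
  is_derive (fun w => g (s w) (t w)) z
    (D1 g (s z) (t z) * ds + D2 g (s z) (t z) * dt).
Proof.
intros L Hs Ht; apply is_derive_Reals, derivable_pt_lim_comp_2d;
  [|now apply is_derive_Reals|now apply is_derive_Reals].
apply filterdiff_differentiable_pt_lim.
destruct (locally_2d_singleton _ _ _ L) as (_ & _ & E2 & C1 & _).
apply (is_derive_filterdiff g (s z) (t z) (D1 g)).
- apply locally_2d_locally in L; apply filter_imp with (2 := L).
  intros w (_ & E1 & _); apply Derive_correct, E1.
- apply Derive_correct, E2.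
- apply Ck_at_continuous, continuity_2d_pt_filterlim in C1; exact C1.
Qed.

(** Induction on k: the mean value theorem turns the estimates for the remainders of [D1 g] and
    [D2 g] into one for g, gaining a factor |u|. *)
Lemma taylor_line (k : nat) (g : R -> R -> R) (a b v eps : R) :
  locally_2d (Ck_at k g) a b -> 0 < eps ->
  locally 0 (fun u => Rabs (g (a + u) (b + u * v) - taylor k g a b u (u * v))
    <= eps * Rabs u ^ k).
Proof.
set (s := fun u : R => a + u); set (t := fun u : R => b + u * v).
assert (Ds : forall u, is_derive s u 1).
{ intros u; unfold s; auto_derive; [auto | ring]. }
assert (Dt : forall u, is_derive t u v).
{ intros u; unfold t; auto_derive; [auto | ring]. }
assert (s0 : s 0 = a) by (unfold s; ring).
assert (t0 : t 0 = b) by (unfold t; ring).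
revert g eps; induction k as [|k IH]; intros g eps L e0.
- assert (C := locally_2d_singleton _ _ _ L (mkposreal eps e0)); simpl in C.
  rewrite <- s0, <- t0 in C at 1.
  generalize (locally_2d_comp _ _ _ _ _ _ (Ds 0) (Dt 0) C).
  apply filter_imp; intros u Hu.
  unfold s, t, taylor in *; simpl.
  rewrite Rinv_1, !Rmult_1_r; lra.
(* The two remainders enter with weights 1 and v, so their bounds add up to e (1 + |v|) = eps times
   |c|^k. *)
- set (e := eps / (1 + Rabs v)).
  assert (v0 := Rabs_pos v).
  assert (ee : 0 < e) by (apply Rdiv_lt_0_compat; lra).
  assert (L1 : locally_2d (Ck_at k (D1 g)) a b).
  { apply locally_2d_impl with (2 := L), locally_2d_forall; intros x y H; apply H. }
  assert (L2 : locally_2d (Ck_at k (D2 g)) a b).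
  { apply locally_2d_impl with (2 := L), locally_2d_forall; intros x y H; apply H. }
  assert (L0 := locally_2d_open _ _ _ L).
  rewrite <- s0, <- t0 in L0 at 1.
  apply (locally_2d_comp _ _ _ _ _ _ (Ds 0) (Dt 0)) in L0.
  destruct (filter_and _ _ L0 (filter_and _ _ (IH _ _ L1 ee) (IH _ _ L2 ee)))
    as [d Hd].
  exists d; intros u Hu.
  set (psi := fun u => g (s u) (t u) - taylor (S k) g a b u (u * v)).
  set (dpsi := fun u => (D1 g (s u) (t u) - taylor k (D1 g) a b u (u * v))
    + v * (D2 g (s u) (t u) - taylor k (D2 g) a b u (u * v))).
  assert (near : forall c, Rmin 0 u <= c <= Rmax 0 u ->
    Rabs c <= Rabs u /\ ball 0 d c).
  { intros c Hc; assert (Rabs c <= Rabs u).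
    { revert Hc; unfold Rmin, Rmax, Rabs.
      destruct (Rle_dec 0 u), (Rcase_abs c), (Rcase_abs u); lra. }
    split; [assumption|].
    assert (Hu' : Rabs (u - 0) < d) by exact Hu.
    change (Rabs (c - 0) < d); rewrite Rminus_0_r in *; lra. }
  assert (Dpsi : forall c, Rmin 0 u <= c <= Rmax 0 u -> is_derive psi c (dpsi c)).
  { intros c Hc; destruct (Hd c (proj2 (near c Hc))) as [Lc _].
    eapply is_derive_eq.
    - apply (@is_derive_minus R_AbsRing R_NormedModule);
        [apply (Ck_at_chain k g s t c _ _ Lc (Ds c) (Dt c))|].
      apply is_derive_taylor_line.
    - unfold dpsi, minus, plus, opp; simpl; ring. }
  destruct (MVT_gen psi 0 u dpsi) as (c & Hc & E).
  { intros c Hc; apply Dpsi; lra. }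
  { intros c Hc; apply continuity_pt_filterlim.
    apply (@ex_derive_continuous R_AbsRing R_NormedModule).
    eexists; apply Dpsi, Hc. }
  assert (psi0 : psi 0 = 0).
  { unfold psi; rewrite s0, t0, Rmult_0_l, taylor_center; ring. }
  rewrite psi0, !Rminus_0_r in E.
  change (Rabs (psi u) <= eps * Rabs u ^ S k).
  rewrite E, Rabs_mult, <- tech_pow_Rmult.
  destruct (near c Hc) as [cu cd]; destruct (Hd c cd) as [_ [B1 B2]].
  assert (P : Rabs c ^ k <= Rabs u ^ k).
  { apply pow_incr; split; [apply Rabs_pos | exact cu]. }
  assert (B : Rabs (dpsi c) <= eps * Rabs u ^ k).
  { apply Rle_trans with (e * Rabs c ^ k + Rabs v * (e * Rabs c ^ k)).
    - unfold dpsi; eapply Rle_trans; [apply Rabs_triang|].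
      apply Rplus_le_compat; [exact B1|].
      rewrite Rabs_mult; apply Rmult_le_compat_l; [apply Rabs_pos | exact B2].
    - replace (e * Rabs c ^ k + Rabs v * (e * Rabs c ^ k)) with (eps * Rabs c ^ k)
        by (unfold e; field; lra).
      apply Rmult_le_compat_l; lra. }
  replace (eps * (Rabs u * Rabs u ^ k)) with ((eps * Rabs u ^ k) * Rabs u) by ring.
  apply Rmult_le_compat_r; [apply Rabs_pos | exact B].
Qed.

(** * Regular pullbacks of functions of class C^k *)

(** For v in [U] the estimate forces p(0, v) = 0, so p = u p1 there, and p1 satisfies the estimate
    with exponent one less. Dividing by |u| is what requires u <> 0 in it. A single p' serves all v
    in [U], as the divisions are made on polynomials. *)
Lemma is_poly2_littleo (m : nat) (p : R -> R -> R) (U : R -> Prop) :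
  is_poly2 p ->
  (forall v eps, U v -> 0 < eps ->
    locally 0 (fun u => u <> 0 -> Rabs (p u v) <= eps * Rabs u ^ m)) ->
  exists p', is_poly2 p' /\ forall u v, U v -> p u v = u ^ S m * p' u v.
Proof.
assert (root : forall m p, is_poly2 p -> forall v,
  (forall eps, 0 < eps ->
    locally 0 (fun u => u <> 0 -> Rabs (p u v) <= eps * Rabs u ^ m)) -> p 0 v = 0).
{ clear; intros m p Hp v H; apply NNPP; intros N.
  assert (e0 : 0 < Rabs (p 0 v) / 2) by (apply Rabs_pos_lt in N; lra).
  assert (C := locally_2d_1d_const_y _ _ _
    (is_poly2_continuous p 0 v Hp (mkposreal _ e0))).
  destruct (filter_and _ _ C (H _ e0)) as [d Hd].
  assert (d0 := cond_pos d).
  (* With u <= 1 the power of |u| is at most 1, so |p(u, v)| <= |p(0, v)|/2, while by continuity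
     p(u, v) differs from p(0, v) by less than that. *)
  set (u := Rmin (d / 2) 1).
  assert (u0 : 0 < u) by (apply Rmin_pos; lra).
  assert (ud : u <= d / 2) by apply Rmin_l.
  assert (u1 : u <= 1) by apply Rmin_r.
  destruct (Hd u) as [A B].
  { change (Rabs (u - 0) < d); rewrite Rminus_0_r, Rabs_pos_eq; lra. }
  simpl in A; specialize (B ltac:(lra)).
  assert (P : Rabs u ^ m <= 1).
  { rewrite <- (pow1 m); apply pow_incr; rewrite Rabs_pos_eq; lra. }
  assert (Q : Rabs (p 0 v) / 2 * Rabs u ^ m <= Rabs (p 0 v) / 2 * 1)
    by (apply Rmult_le_compat_l; lra).
  assert (T := Rabs_triang_inv (p 0 v) (p u v)).
  rewrite Rabs_minus_sym in T; lra. }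
revert p; induction m as [|m IH]; intros p Hp H;
  destruct (is_poly2_factor_fst p Hp) as (p1 & Hp1 & E).
- exists p1; split; [exact Hp1|]; intros u v Uv.
  rewrite E, (root _ p Hp v (fun eps => H v eps Uv)); ring.
- destruct (IH p1 Hp1) as (p' & Hp' & E').
  { intros v eps Uv e0; generalize (H v eps Uv e0); apply filter_imp; intros u B u0.
    specialize (B u0).
    rewrite E, (root _ p Hp v (fun eps => H v eps Uv)), Rplus_0_l in B.
    rewrite Rabs_mult, <- tech_pow_Rmult in B.
    apply (Rmult_le_reg_l (Rabs u)); [now apply Rabs_pos_lt | lra]. }
  exists p'; split; [exact Hp'|]; intros u v Uv.
  rewrite E, (root _ p Hp v (fun eps => H v eps Uv)), E' by exact Uv.
  simpl; ring.
Qed.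

(** Clearing the denominator leaves r = (g - T) q. As q is bounded near each point, r is o(u^k) on
    the lines with q(0, v) <> 0, hence divisible by u^(k+1) there. *)
Lemma chart_order_taylor (k : nat) (g T : R -> R -> R) (a b : R) :
  is_poly2 T ->
  (forall v, regular_at (chart1 (a, b) g) 0 v) ->
  (forall v eps, 0 < eps -> locally 0 (fun u =>
    Rabs (g (a + u) (b + u * v) - T (a + u) (b + u * v)) <= eps * Rabs u ^ k)) ->
  chart_order (S k) (fun x y => g x y - T x y) a b.
Proof.
intros HT Hg H; apply chart_order_intro; intros v0.
destruct (Hg v0) as (p & q & Hp & Hq & q0 & E).
set (r := fun u v => p u v - T (a + u) (b + u * v) * q u v).
assert (Hr : is_poly2 r).
{ apply is_poly2_minus; [exact Hp|]; apply is_poly2_mult; [|exact Hq].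
  apply (is_poly2_comp T (fun u v => a + u) (fun u v => b + u * v)); auto with poly2. }
assert (Er : forall u v, q u v <> 0 ->
  g (a + u) (b + u * v) - T (a + u) (b + u * v) = r u v / q u v).
{ intros u v n; assert (E' := E u v n); unfold chart1 in E'; simpl in E'.
  rewrite E'; unfold r; field; exact n. }
destruct (is_poly2_littleo k r (fun v => q 0 v <> 0) Hr) as (r' & Hr' & F).
{ intros v eps n e0.
  assert (M : 0 < Rabs (q 0 v) + 1) by (assert (A := Rabs_pos (q 0 v)); lra).
  assert (C := is_poly2_continuous q 0 v Hq).
  assert (C1 := locally_2d_1d_const_y _ _ _ (C (mkposreal 1 Rlt_0_1))).
  assert (C2 := locally_2d_1d_const_y _ _ _ (continuity_2d_pt_neq_0 _ _ _ C n)).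
  generalize (filter_and _ _ (filter_and _ _ C1 C2)
    (H v _ (Rdiv_lt_0_compat _ _ e0 M))).
  apply filter_imp; intros u [[A N] B] _; simpl in A.
  rewrite (Er u v N) in B.
  assert (qb : Rabs (q u v) <= Rabs (q 0 v) + 1).
  { assert (T1 := Rabs_triang_inv (q u v) (q 0 v)); lra. }
  replace (r u v) with (r u v / q u v * q u v) by (field; exact N).
  rewrite Rabs_mult.
  replace (eps * Rabs u ^ k) with
    (eps / (Rabs (q 0 v) + 1) * Rabs u ^ k * (Rabs (q 0 v) + 1)) by (field; lra).
  apply Rmult_le_compat; auto using Rabs_pos. }
exists r', q; split; [exact Hr'|]; split; [exact Hq|]; split; [exact q0|].
assert (L := continuity_2d_pt_neq_0 q 0 v0 (is_poly2_continuous q 0 v0 Hq) q0).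
destruct L as [d Hd]; exists d; intros u v hu hv u0 n.
(* The factorisation of [r] asks for q(0, v) <> 0, obtained from the neighbourhood at the point (0,
   v) of the divisor. *)
rewrite Er, F by (auto; apply Hd; auto; rewrite Rminus_diag, Rabs_R0; apply cond_pos).
field; exact n.
Qed.

Lemma Ck_at_swap (k : nat) (g : R -> R -> R) (a b : R) :
  Ck_at k g a b -> Ck_at k (swap g) b a.
Proof.
assert (C : forall g, continuity_2d_pt g a b -> continuity_2d_pt (swap g) b a).
{ intros f Hf eps; destruct (Hf eps) as [d Hd]; exists d; intros u v hu hv.
  now apply Hd. }
revert g; induction k as [|k IH]; intros g; simpl; [apply C|].
intros (H0 & H1 & H2 & H3 & H4).
split; [now apply C|]; split; [exact H2|]; split; [exact H1|].
split; [apply (IH (D2 g) H4) | apply (IH (D1 g) H3)].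
Qed.

Definition regular_on_charts (f : R -> R -> R) (a b : R) : Prop :=
  (forall v, regular_at (chart1 (a, b) f) 0 v) /\
  (forall u, regular_at (chart2 (a, b) f) u 0).

Lemma regular_at_swap (f : R -> R -> R) (x y : R) :
  regular_at f x y -> regular_at (swap f) y x.
Proof.
intros (p & q & Hp & Hq & q0 & E); exists (swap p), (swap q).
split; [now apply is_poly2_swap|]; split; [now apply is_poly2_swap|].
split; [exact q0|]; intros u v n; apply E, n.
Qed.

Lemma regular_on_charts_swap (f : R -> R -> R) (a b : R) :
  regular_on_charts f a b -> regular_on_charts (swap f) b a.
Proof.
assert (comm : forall c d : R -> R -> R, c = d ->
  forall x y, regular_at c x y -> regular_at d x y) by (now intros c d ->).
intros [H1 H2]; split; intros v.
- apply (comm (swap (chart2 (a, b) f))); [|apply regular_at_swap, H2].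
  extensionality u; extensionality w; unfold swap, chart1, chart2; simpl.
  f_equal; ring.
- apply (comm (swap (chart1 (a, b) f))); [|apply regular_at_swap, H1].
  extensionality u; extensionality w; unfold swap, chart1, chart2; simpl.
  f_equal; ring.
Qed.

Lemma directional_swap (i : nat) (g : R -> R -> R) (a b u w : R) :
  directional i (swap g) b a w u = directional i g a b u w.
Proof.
revert g; induction i as [|i IH]; intros g; [reflexivity|].
change (w * directional i (swap (D2 g)) b a w u
  + u * directional i (swap (D1 g)) b a w u
  = u * directional i (D1 g) a b u w + w * directional i (D2 g) a b u w).
rewrite !IH; ring.
Qed.

Lemma taylor_swap (k : nat) (g : R -> R -> R) (a b u w : R) :
  taylor k (swap g) b a w u = taylor k g a b u w.
Proof. apply sum_eq; intros i _; now rewrite directional_swap. Qed.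

(** One Taylor polynomial serves both charts, since Taylor expansion commutes with swapping. Its
    value at the centre is recorded because the order ignores that point. *)
Lemma blowup_order_taylor (k : nat) (g : R -> R -> R) (a b : R) :
  locally_2d (Ck_at k g) a b -> regular_on_charts g a b ->
  exists T, is_poly2 T /\ T a b = g a b /\
    blowup_order (S k) (fun x y => g x y - T x y) a b.
Proof.
intros L H.
set (T := fun x y => taylor k g a b (x - a) (y - b)).
assert (HT : is_poly2 T).
{ apply (is_poly2_comp (taylor k g a b) (fun x _ => x - a) (fun _ y => y - b));
    auto using is_poly2_taylor with poly2. }
exists T; split; [exact HT|]; split.
{ unfold T; rewrite !Rminus_diag; apply taylor_center. }
split.
- apply chart_order_taylor; [exact HT | apply H|].
  intros v eps e0; generalize (taylor_line k g a b v eps L e0).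
  apply filter_imp; intros u B; unfold T.
  now rewrite !Rplus_minus_l.
- apply (chart_order_taylor k (swap g) (swap T)).
  + now apply is_poly2_swap.
  + apply regular_on_charts_swap, H.
  + assert (L' : locally_2d (Ck_at k (swap g)) b a).
    { destruct L as [d Hd]; exists d; intros x y hx hy; now apply Ck_at_swap, Hd. }
    intros v eps e0; generalize (taylor_line k (swap g) b a v eps L' e0).
    apply filter_imp; intros u B; rewrite taylor_swap in B; unfold swap, T in *.
    now rewrite !Rplus_minus_l.
Qed.

Lemma regular_on_charts_order (f : R -> R -> R) (a b : R) :
  regular_on_charts f a b -> blowup_order 0 f a b.
Proof.
assert (chart : forall f a b, regular_on_charts f a b -> chart_order 0 f a b).
{ clear; intros f a b [H _]; apply chart_order_intro; intros v0.
  destruct (H v0) as (p & q & Hp & Hq & q0 & E).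
  exists p, q; split; [exact Hp|]; split; [exact Hq|]; split; [exact q0|].
  apply locally_2d_forall; intros u v _ n; simpl; rewrite Rmult_1_l.
  exact (E u v n). }
intros H; split; apply chart; [exact H | now apply regular_on_charts_swap].
Qed.

(** * Regular pullbacks of products *)

Lemma regular_at_comp (f s t : R -> R -> R) (x y : R) :
  is_poly2 s -> is_poly2 t -> regular_at f (s x y) (t x y) ->
  regular_at (fun u v => f (s u v) (t u v)) x y.
Proof.
intros Hs Ht (p & q & Hp & Hq & q0 & E).
exists (fun u v => p (s u v) (t u v)), (fun u v => q (s u v) (t u v)).
split; [now apply is_poly2_comp|]; split; [now apply is_poly2_comp|].
split; [exact q0|]; intros u v n; apply E, n.
Qed.

Lemma regular_at_mult (f g : R -> R -> R) (x y : R) :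
  regular_at f x y -> regular_at g x y ->
  regular_at (fun u v => f u v * g u v) x y.
Proof.
intros (p1 & q1 & Hp1 & Hq1 & n1 & E1) (p2 & q2 & Hp2 & Hq2 & n2 & E2).
exists (fun u v => p1 u v * p2 u v), (fun u v => q1 u v * q2 u v).
split; [auto with poly2|]; split; [auto with poly2|].
split; [now apply Rmult_integral_contrapositive_currified|].
intros u v n; apply Rmult_neq_0_reg in n; destruct n as [m1 m2].
rewrite E1, E2 by assumption; field; auto.
Qed.

Lemma regular_at_regular_on_charts (f : R -> R -> R) (a b : R) :
  regular_at f a b -> regular_on_charts f a b.
Proof.
intros H; split; intros v.
- apply (regular_at_comp f (fun u v => a + u) (fun u v => b + u * v));
    auto with poly2.
  now rewrite Rmult_0_l, !Rplus_0_r.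
- apply (regular_at_comp f (fun u v => a + u * v) (fun u v => b + v));
    auto with poly2.
  now rewrite Rmult_0_r, !Rplus_0_r.
Qed.

Lemma regular_after_blowup_on_charts (S : list (R * R)) (f : R -> R -> R) (a b : R) :
  regular_after_blowup S f -> regular_on_charts f a b.
Proof.
intros [H1 H2]; destruct (classic (In (a, b) S)) as [i|n].
- split; apply (H2 _ i).
- now apply regular_at_regular_on_charts, H1.
Qed.

(** A centre for one factor need not be one for the other, but a function regular at a point also
    has regular pullback in both charts there. *)
Lemma regular_after_blowup_mult (S S' : list (R * R)) (f g : R -> R -> R) :
  regular_after_blowup S f -> regular_after_blowup S' g ->
  regular_after_blowup (S ++ S') (fun x y => f x y * g x y).
Proof.
intros Hf Hg; split.
- intros x y n; apply regular_at_mult; [apply Hf | apply Hg];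
    intros i; apply n, in_or_app; auto.
- intros [a b] _.
  destruct (regular_after_blowup_on_charts S f a b Hf) as [F1 F2].
  destruct (regular_after_blowup_on_charts S' g a b Hg) as [G1 G2].
  split; intros v.
  + apply (regular_at_mult (chart1 (a, b) f) (chart1 (a, b) g)); auto.
  + apply (regular_at_mult (chart2 (a, b) f) (chart2 (a, b) g)); auto.
Qed.

Lemma exists_not_In (S : list (R * R)) : exists x y, ~ In (x, y) S.
Proof.
assert (B : exists M, forall p, In p S -> fst p < M).
{ induction S as [|q S [M HM]]; [exists 0; intros p []|].
  exists (Rmax M (fst q + 1)); intros p [<-|i].
  - assert (H := Rmax_r M (fst q + 1)); lra.
  - assert (H := Rmax_l M (fst q + 1)); specialize (HM p i); lra. }
destruct B as [M HM]; exists M, 0; intros i.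
apply HM in i; simpl in i; lra.
Qed.

(** Regularity at one point outside the finite set [S] already provides the fraction p/q, and q
    itself cuts out the Zariski open set. *)
Lemma regulous_1_intro (k : nat) (S : list (R * R)) (f : R -> R -> R) :
  Ck2 k f -> regular_after_blowup S f -> regulous_1 k f.
Proof.
intros C H; split; [|now exists S]; split; [exact C|].
destruct (exists_not_In S) as (x0 & y0 & n).
destruct (proj1 H x0 y0 n) as (p & q & Hp & Hq & q0 & E).
exists p, q, q; split; [|split; [|split; [|split]]]; auto.
now exists x0, y0.
Qed.

Theorem theorem3p7 (k : nat) (f h : R -> R -> R)
  (hf : regulous_1 k f) (hh : regulous_1 (S k) h)
  (hpol : forall x y, pol f x y -> Zset h x y) :
  regulous_1 (S k) (fun x y => h x y * f x y).
Proof.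
destruct hf as [[Cf _] [Sf Rf]]; destruct hh as [[Ch _] [Sh Rh]].
apply (regulous_1_intro _ (Sh ++ Sf)); [|now apply regular_after_blowup_mult].
apply Ck2_iff; intros a b.
assert (chf := regular_after_blowup_on_charts Sf f a b Rf).
assert (chh := regular_after_blowup_on_charts Sh h a b Rh).
destruct (blowup_order_taylor (S k) h a b) as (U & HU & U0 & OU); auto.
{ now apply locally_2d_forall, Ck2_iff. }
assert (T : exists T, is_poly2 T /\ T a b = f a b /\
  blowup_order (S (S k)) (fun x y => U x y * (f x y - T x y)) a b).
{ destruct (classic (regular_at f a b)) as [r|n].
  (* Where f is regular it is of class C^(k+1) nearby, so order k + 2 is reached by f - T alone and
     [U] need only have order 0. *)
  - destruct (blowup_order_taylor (S k) f a b) as (T & HT & T0 & OT);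
      auto using regular_at_Ck_at.
    exists T; split; [exact HT|]; split; [exact T0|].
    apply (blowup_order_mult 0 (S (S k))); [|exact OT].
    apply regular_on_charts_order, regular_at_regular_on_charts.
    exists U, (fun _ _ => 1); split; [exact HU|]; split; [auto with poly2|].
    split; [apply R1_neq_R0 | intros; field].
  - destruct (blowup_order_taylor k f a b) as (T & HT & T0 & OT); auto.
    { now apply locally_2d_forall, Ck2_iff. }
    exists T; split; [exact HT|]; split; [exact T0|].
    (* At a pole f is only known to be C^k; the missing order comes from U(a, b) = h(a, b) = 0. *)
    apply (blowup_order_mult 1 (S k)); [|exact OT].
    apply blowup_order_poly_root; [exact HU|].
    rewrite U0; apply hpol, n. }
destruct T as (T & HT & T0 & OT).
apply (blowup_order_Ck_at (S k) _ (fun x y => U x y * T x y)).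
- auto with poly2.
- apply (blowup_order_ext _
    (fun x y => U x y * (f x y - T x y) + (h x y - U x y) * f x y)).
  { intros; ring. }
  apply blowup_order_plus; [exact OT|].
  (* The factor h - U has order k + 2, and f, whose pullback is regular, has order 0. *)
  rewrite <- (Nat.add_0_r (S (S k))); apply blowup_order_mult; [exact OU|].
  now apply regular_on_charts_order.
- now rewrite U0, T0.
Qed.
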